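(* Let $k$ be a field, let $(\Lambda,G,\eta)$ be an admissible set of data, $L=\Lambda/G$, let $l,l',l''\in L$ and let $c,c',c''$ be conjugacy classes of $G$. Then $$\xi(l',c';l)\,\xi(l'',c'';l)\,S_{c'(l),c''(l)}^{c(l)}=\sum_{\tilde l\in L}\xi(\tilde l,c;l)\,P_{(l',c'),(l'',c'')}^{(\tilde l,c)},$$ where $P$ are the structure constants of the algebra $A(\Lambda,G,\eta)$ of conjugacy classes of partial elements over $k$ and $S$ are the structure constants of the center $Z(k[G_l])$ of the group algebra.
   Context: Admissible poset: a poset $\Lambda$ with a minimal element $0$ (so $0\preceq\lambda$ for all $\lambda$), such that $\{\lambda'\mid\lambda'\preceq\lambda\}$ is finite for each $\lambda$ and each finite subset has a supremum. The supremum of $\lambda',\lambda''$ is denoted $\lambda'\wedge\lambda''$. Let $G$ be a group acting on $\Lambda$ by order automorphisms, let $\mathrm{Sub}(G)$ be the poset of subgroups of $G$ (ordered by inclusion, $G$ acting by conjugation), and let $\eta:\Lambda\to\mathrm{Sub}(G)$, $\lambda\mapsto G_\lambda$, be order preserving and $G$-equivariant ($G_{g\lambda}=gG_\lambda g^{-1}$). Put $L=\Lambda/G$, with $l'\preceq l''$ iff $\lambda'\preceq\lambda''$ for some $\lambda'\in l',\lambda''\in l''$. For $l',l''\in L$, $l'\wedge l''\subset L$ is the set of orbits of all elements $\lambda'\wedge\lambda''$, $\lambda'\in l'$, $\lambda''\in l''$. $G_l$ denotes the conjugacy class of the subgroups $G_\lambda$, $\lambda\in l$ (or a representative of it). A partial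 element is a pair $(\lambda,h)$ with $\lambda\in\Lambda$, $h\in G_\lambda$; $G$ acts on partial elements by $g(\lambda,h)=(g\lambda,ghg^{-1})$ (conjugation), and orbits are called conjugacy classes of partial elements. $(\Lambda,G,\eta)$ is an admissible set of data if $\Lambda$ is admissible and: (1) $G_0=\{e\}$; (2) every $G_\lambda$ is finite; (3) $l'\wedge l''$ is a finite set for all $l',l''\in L$; (4) if $l'\wedge x=l''\wedge x$ for all $x\in L$ and $G_{l'}=G_{l''}$, then $l'=l''$; (5) for any $\lambda',\lambda''\preceq\lambda$, any two partial elements $(\lambda',h'),(\lambda'',h'')$ conjugated by an element of $G$ are conjugated by an element of $G_\lambda$. Standing assumptions: $G=\bigcup_\lambda G_\lambda$; each $G_\lambda$ maps $\{\mu\mid\mu\preceq\lambda\}$ to itself (equivalently, fixes $\lambda$); for each conjugacy class $c$ of $G$ and each $\lambda$, $c\cap G_\lambda$ is empty or a single conjugacy class of $G_\lambda$. For $l\in L$ and a conjugacy class $c$ of $G$, let $(l,c)=\{(\lambda,h)\mid\lambda\in l,\ h\in c\cap G_\lambda\}$; it is empty or a conjugacy class of partial elements, and every conjugacy class of partial elements has this form. Partial elements are multiplied by $(\lambda',h')(\lambda'',h'')=(\lambda'\wedge\lambda'',h'h'')$. $e_{(l,c)}$ is the formal sum of all elements of $(l,c)$ ($e_{(l,c)}=0$ if $(l,c)=\emptyset$). $A=A(\Lambda,G,\eta)$ is the $k$-vector space with basis the nonzero $e_{(l,c)}$, a commutative associative algebra under the multiplication induced by that of partial elements; $P_{\omega',\omega''}^{\omega}$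 is the coefficient of $e_\omega$ in $e_{\omega'}e_{\omega''}$ (set to $0$ if any of $\omega,\omega',\omega''$ is empty). For $c$ meeting $G_\lambda$ ($\lambda\in l$), $c(l)=c(\lambda)=c\cap G_\lambda$, and $e_{c(l)}$ is the sum of its elements; these form a basis of $Z(k[G_l])$ (the center of $k[G_\lambda]$, $\lambda\in l$, canonically the same for all $\lambda\in l$). $S_{c'(l),c''(l)}^{c(l)}$ is the coefficient of $e_{c(l)}$ in $e_{c'(l)}e_{c''(l)}$, set to $0$ if any of $c,c',c''$ does not meet $G_\lambda$. For $l',l\in L$, $\xi(l',c;l)$ is the number of $\lambda'\in l'$ with $\lambda'\preceq\lambda$ and $h\in G_{\lambda'}$, where $\lambda\in l$ and $h\in c\cap G_\lambda$ are fixed (independent of the choice; $0$ if $c\cap G_\lambda=\emptyset$). *)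

(* Defs.v *)
From HB Require Import structures.
From mathcomp Require Import all_boot all_order all_algebra finmap.
From mathcomp Require Import boolp classical_sets functions cardinality fsbigop.

Set Implicit Arguments.
Unset Strict Implicit.
Unset Printing Implicit Defensive.

Import Order.TTheory GRing.Theory.

Local Open Scope classical_set_scope.
Local Open Scope ring_scope.

Definition conjg_by (G : groupType) (g h : G) : G := (g * h * g^-1)%g.

Definition conj_class (G : groupType) (h : G) : set G :=
  [set conjg_by g h | g in [set: G]].

Definition conj_classes {G : groupType} : set (set G) :=
  [set conj_class h | h in [set: G]].

(* A [bJoinSemilatticeType] is a poset with a least element [\bot] and suprema
   of pairs, i.e. a poset in which every finite subset (the empty one included)
   has a supremum.  The supremum, [x `|` y] here, is the operation written
   with a wedge in the theory of partial elements. *)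
Record data (d : Order.disp_t) (Lam : bJoinSemilatticeType d) (G : groupType)
  := Data {
  act : G -> Lam -> Lam;
  act1 : forall x, act 1%g x = x;
  actM : forall g h x, act (g * h)%g x = act g (act h x);
  act_le : forall g x y, (act g x <= act g y)%O = (x <= y)%O;
  eta : Lam -> set G;
  eta_group : forall x, group_closed [in eta x];
  eta_mono : forall x y, (x <= y)%O -> eta x `<=` eta y;
  eta_act : forall g x, eta (act g x) = [set conjg_by g h | h in eta x]
}.

Section PartialElements.
Context (d : Order.disp_t) (Lam : bJoinSemilatticeType d) (G : groupType).
Variable D : data Lam G.

Definition orbit (x : Lam) : set Lam := [set act D g x | g in [set: G]].

(* L = Lambda / G, as the set of orbits. *)
Definition orbits : set (set Lam) := [set orbit x | x in [set: Lam]].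

Definition orbit_join (l' l'' : set Lam) : set (set Lam) :=
  [set orbit (x `|` y)%O | x in l' & y in l''].

Definition orbit_groups (l : set Lam) : set (set G) := [set eta D x | x in l].

Definition partial_elt (p : Lam * G) : Prop := eta D p.1 p.2.

Definition pe_act (g : G) (p : Lam * G) : Lam * G :=
  (act D g p.1, conjg_by g p.2).

Definition pe_mul (p q : Lam * G) : Lam * G :=
  ((p.1 `|` q.1)%O, (p.2 * q.2)%g).

Record admissible : Prop := Admissible {
  down_finite : forall x : Lam, finite_set [set y : Lam | (y <= x)%O];
  eta_bot : eta D \bot%O = [set 1%g];
  eta_finite : forall x, finite_set (eta D x);
  orbit_join_finite : forall l' l'', orbits l' -> orbits l'' ->
    finite_set (orbit_join l' l'');
  orbit_separated : forall l' l'', orbits l' -> orbits l'' ->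
    (forall x, orbits x -> orbit_join l' x = orbit_join l'' x) ->
    orbit_groups l' = orbit_groups l'' -> l' = l'';
  pe_conj_local : forall (x : Lam) (p' p'' : Lam * G),
    (p'.1 <= x)%O -> (p''.1 <= x)%O -> partial_elt p' -> partial_elt p'' ->
    (exists g, pe_act g p' = p'') ->
    exists2 g, eta D x g & pe_act g p' = p''
}.

Record standing : Prop := Standing {
  eta_cover : [set: G] = \bigcup_(x in [set: Lam]) eta D x;
  eta_down : forall x g, eta D x g ->
    [set act D g y | y in [set y | (y <= x)%O]] `<=` [set y | (y <= x)%O];
  conj_class_local : forall c x, conj_classes c ->
    c `&` eta D x = set0 \/
    exists2 h, eta D x h & c `&` eta D x = [set conjg_by g h | g in eta D x]
}.

(* The set (l,c). *)
Definition pe_class (l : set Lam) (c : set G) : set (Lam * G) :=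
  [set p | l p.1 /\ (c `&` eta D p.1) p.2].

(* The number of x' in l' with x' <= x and h in G_x'. *)
Definition xi_at (l' : set Lam) (x : Lam) (h : G) : nat :=
  #|` fset_set [set x' | [/\ l' x', (x' <= x)%O & eta D x' h]]|.

(* A chosen element of the orbit l; [xiE] and [centerSE] below show that the
   choice does not matter. *)
Definition orbit_repr (l : set Lam) : Lam := xget \bot%O l.

(* c(l), as a subset of G_x for the chosen x in l. *)
Definition class_in (l : set Lam) (c : set G) : set G :=
  c `&` eta D (orbit_repr l).

Definition xi (l' : set Lam) (c : set G) (l : set Lam) : nat :=
  if class_in l c == set0 then 0%N
  else xi_at l' (orbit_repr l) (xget 1%g (class_in l c)).

End PartialElements.

(* Formal, possibly infinite, linear combinations of elements of T are functions
   T -> k. *)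
Section FormalSums.
Context (k : fieldType) (T : choiceType).

Definition set_sum (X : set T) : T -> k^o := fun t => (t \in X)%:R.

(* The product induced by mul; it is used only when the sum is finitely
   supported, see [pe_prod_finite] and [group_prod_finite]. *)
Definition formal_mul (mul : T -> T -> T) (f g : T -> k^o) : T -> k^o :=
  fun t => \sum_(p \in [set p : T * T | mul p.1 p.2 = t]) (f p.1 * g p.2).

Definition coords_of (B : set (set T)) (f : T -> k^o) (a : set T -> k) : Prop :=
  [/\ finite_set [set X | a X != 0],
      forall X, ~ B X -> a X = 0 &
      f = \sum_(X \in B) a X *: set_sum X].

(* The coordinates of f in the family of the set_sum X, X in B. *)
Definition coords (B : set (set T)) (f : T -> k^o) : set T -> k :=
  xget (fun=> 0) (coords_of B f).

End FormalSums.

Section StructureConstants.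
Context (d : Order.disp_t) (Lam : bJoinSemilatticeType d) (G : groupType).
Variables (k : fieldType) (D : data Lam G).

Definition pe_classes : set (set (Lam * G)) :=
  [set pe_class D l c | l in orbits D & c in conj_classes] `\ set0.

(* The algebra A(Lambda, G, eta), as a set of formal sums of partial elements,
   with product [formal_mul (@pe_mul d Lam G)]. *)
Definition pe_algebra : set (Lam * G -> k^o) :=
  [set f | exists a, coords_of pe_classes f a].

(* The coefficient P_{w',w''}^w. *)
Definition pe_coef (w' w'' w : set (Lam * G)) : k :=
  if [|| w' == set0, w'' == set0 | w == set0] then 0
  else coords pe_classes
         (formal_mul (@pe_mul d Lam G) (set_sum k w') (set_sum k w'')) w.

(* k[H] inside the formal sums of elements of G. *)
Definition group_algebra (H : set G) : set (G -> k^o) :=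
  [set f | forall g, ~ H g -> f g = 0].

Definition group_center (H : set G) : set (G -> k^o) :=
  [set f | group_algebra H f /\ forall f', group_algebra H f' ->
     formal_mul *%g f f' = formal_mul *%g f' f].

Definition group_classes (x : Lam) : set (set G) :=
  [set c `&` eta D x | c in conj_classes] `\ set0.

(* The structure constants of the center of k[G_x] in the basis of class sums,
   see [group_centerE]. *)
Definition centerS_at (x : Lam) (c' c'' c : set G) : k :=
  if [|| c' `&` eta D x == set0, c'' `&` eta D x == set0
       | c `&` eta D x == set0] then 0
  else coords (group_classes x)
         (formal_mul *%g (set_sum k (c' `&` eta D x))
                         (set_sum k (c'' `&` eta D x)))
         (c `&` eta D x).

Definition centerS (l : set Lam) (c' c'' c : set G) : k :=
  centerS_at (orbit_repr l) c' c'' c.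

End StructureConstants.

Section ConjTheory.
Context (G : groupType).
Implicit Types (g h x y : G) (c : set G).

Lemma conjg_byE g h : conjg_by g h = (h ^ g^-1)%g.
Proof. by rewrite /conjg_by conjgE invgK mulgA. Qed.

Lemma conjg_by1 h : conjg_by 1%g h = h.
Proof. by rewrite conjg_byE invg1 conjg1. Qed.

Lemma conjg_byM g g' h : conjg_by (g * g')%g h = conjg_by g (conjg_by g' h).
Proof. by rewrite !conjg_byE invgM conjgM. Qed.

Lemma conjg_byK g : cancel (conjg_by g) (conjg_by g^-1%g).
Proof. by move=> h; rewrite -conjg_byM mulVg conjg_by1. Qed.

Lemma conjg_byVK g : cancel (conjg_by g^-1%g) (conjg_by g).
Proof. by move=> h; rewrite -conjg_byM mulgV conjg_by1. Qed.

Lemma conjg_byMr g x y :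
  conjg_by g (x * y)%g = (conjg_by g x * conjg_by g y)%g.
Proof. by rewrite !conjg_byE conjMg. Qed.

Lemma conj_class_refl h : conj_class h h.
Proof. by exists 1%g => //; rewrite conjg_by1. Qed.

Lemma conj_classes_by c g h : conj_classes c -> c h -> c (conjg_by g h).
Proof. by move=> [a _ <-] [b _ <-]; exists (g * b)%g; rewrite ?conjg_byM. Qed.

Lemma conj_classes_eq c h : conj_classes c -> c h -> c = conj_class h.
Proof.
move=> [a _ <-] [b _ <-]; apply/seteqP; split => _ [g _ <-].
  by exists (g * b^-1)%g; rewrite // conjg_byM conjg_byK.
by exists (g * b)%g; rewrite // conjg_byM.
Qed.

End ConjTheory.

Section FormalSumsTheory.
Context (k : fieldType) (T : choiceType).
Implicit Types (B : set (set T)) (f : T -> k^o) (X : set T).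

Lemma set_sum_in X t : X t -> set_sum k X t = 1.
Proof. by move=> Xt; rewrite /set_sum mem_set. Qed.

Lemma set_sum_out X t : ~ X t -> set_sum k X t = 0.
Proof. by move=> Xt; rewrite /set_sum memNset. Qed.

Lemma set_sum_neq0 X t : set_sum k X t != 0 -> X t.
Proof. by rewrite /set_sum; case: (boolP (t \in X)); rewrite ?inE// eqxx. Qed.

Lemma scale_set_sumE (u : k) X t : (u *: set_sum k X) t = u * (t \in X)%:R.
Proof. by []. Qed.

Lemma coords_of_val B f a X t :
    (forall X Y u, B X -> B Y -> X u -> Y u -> X = Y) ->
  coords_of B f a -> B X -> X t -> a X = f t.
Proof.
move=> dB [afin aB ->] BX Xt; rewrite fct_sumE.
set F := fun Y => _; set s := finite_support _ _ _.
rewrite -[RHS]/(\sum_(Y <- s) F Y t).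
have sE : s =i B `&` F @^-1` [set~ 0].
  apply: in_finite_support; apply: sub_finite_set afin => Y [_] /=.
  by apply: contra_not_neq; rewrite /F => ->; rewrite scale0r.
have FtE Y : B Y -> F Y t = if Y == X then a X else 0.
  move=> BY; rewrite /F scale_set_sumE.
  case: eqVneq => [->|YX]; first by rewrite mem_set// mulr1.
  rewrite memNset ?mulr0// => Yt; move/eqP: YX; apply.
  exact: dB BY BX Yt Xt.
have [Xs|Xs] := boolP (X \in s).
  rewrite (bigD1_seq X)//= ?finite_support_uniq// (FtE X BX) eqxx.
  rewrite big_seq_cond big1 ?addr0// => Y /andP[+ YX].
  by rewrite sE inE => -[BY _]; rewrite FtE// (negPf YX).
rewrite big_seq big1 => [|Y Ys].
  apply: contraNeq Xs => aX0; rewrite sE inE; split => //= FX0.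
  have := FtE X BX; rewrite FX0 eqxx => aX.
  by rewrite -aX eqxx in aX0.
rewrite FtE; last by move: Ys; rewrite sE inE => -[].
by case: eqVneq => // YX; rewrite -YX Ys in Xs.
Qed.

Lemma coords_of_ex B f :
    (forall X Y u, B X -> B Y -> X u -> Y u -> X = Y) ->
    (forall X t u, B X -> X t -> X u -> f t = f u) ->
    (forall t, f t != 0 -> exists2 X, B X & X t) ->
    finite_set [set X | B X /\ exists2 t, X t & f t != 0] ->
  exists a, coords_of B f a.
Proof.
move=> dB fB fsupp ffin.
pose a X := xget 0 [set v | B X /\ exists2 t, X t & f t = v].
have aE X t : B X -> X t -> a X = f t.
  move=> BX Xt; apply: xget_unique; first by split => //; exists t.
  by move=> v [_ [u Xu <-]]; exact: fB BX Xu Xt.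
have aN X : a X != 0 -> B X /\ exists2 t, X t & f t != 0.
  rewrite {1}/a; case: xgetP => [v ve [BX [t Xt ft]] v0|]; last by rewrite eqxx.
  by split => //; exists t; rewrite ?ft.
have afin : finite_set [set X | a X != 0] by apply: sub_finite_set ffin => X /aN.
have aB X : ~ B X -> a X = 0.
  by move=> NBX; apply/eqP; apply: contra_notT NBX => /aN[].
exists a; split => //; apply/funext => t.
pose g : T -> k^o := \sum_(X \in B) a X *: set_sum k X.
have gB : coords_of B g a by [].
rewrite -/g; have [[X BX Xt]|/forall2NP nX] := pselect (exists2 X, B X & X t).
  by rewrite -(aE X t BX Xt); exact: coords_of_val gB BX Xt.
transitivity (0 : k).
  by apply/eqP; apply: contraT => /fsupp[X BX Xt]; case: (nX X).
rewrite /g fct_sumE big_seq big1// => X; rewrite in_finite_support; last first.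
  apply: sub_finite_set afin => Y [_] /=.
  by apply: contra_not_neq => ->; rewrite scale0r.
rewrite inE => -[BX _]; rewrite scale_set_sumE memNset ?mulr0//.
by case: (nX X).
Qed.

Lemma coordsP B f : (exists a, coords_of B f a) -> coords_of B f (coords B f).
Proof. exact: xgetPex. Qed.

Lemma formal_mul_neq0 mul f f' t : formal_mul mul f f' t != 0 ->
  exists p, [/\ mul p.1 p.2 = t, f p.1 != 0 & f' p.2 != 0].
Proof.
apply: contraPP => /forallNP np; apply/negP; rewrite negbK; apply/eqP/fsbig1.
move=> p /= pt; apply/eqP; apply: contra_notT (np p).
by rewrite mulf_eq0 negb_or => /andP[? ?].
Qed.

Lemma formal_mul_equiv (mul : T -> T -> T) (phi psi : T -> T) X Y t :
    cancel phi psi -> cancel psi phi ->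
    (forall u v, phi (mul u v) = mul (phi u) (phi v)) ->
  formal_mul mul (set_sum k (phi @` X)) (set_sum k (phi @` Y)) (phi t) =
  formal_mul mul (set_sum k X) (set_sum k Y) t.
Proof.
move=> phiK psiK phiM; rewrite /formal_mul.
have ssE Z u : set_sum k (phi @` Z) (phi u) = set_sum k Z u.
  rewrite /set_sum; congr (_%:R); congr nat_of_bool; apply/idP/idP; rewrite !inE.
    by move=> -[v Zv /(can_inj phiK) <-].
  by move=> Zu; exists u.
rewrite (reindex_fsbig (fun p : T * T => (phi p.1, phi p.2))
  [set p : T * T | mul p.1 p.2 = t]); last first.
  split => /=.
  - by move=> p /= pt; rewrite -phiM pt.
  - by move=> [a b] [a' b'] _ _ [/(can_inj phiK)-> /(can_inj phiK)->].
  - move=> [a b] /= ab; exists (psi a, psi b); rewrite /= ?psiK//.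
    by apply: (can_inj phiK); rewrite phiM !psiK.
by apply: eq_fsbigr => p _; rewrite /= !ssE.
Qed.

End FormalSumsTheory.

Section Theory.
Context (d : Order.disp_t) (Lam : bJoinSemilatticeType d) (G : groupType).
Variables (k : fieldType) (D : data Lam G).
Hypotheses (Dadm : admissible D) (Dstd : standing D).
Implicit Types (x y : Lam) (l : set Lam) (c : set G).

Lemma eta1 x : eta D x 1%g.
Proof. by have [+ _] := eta_group D x; rewrite !inE. Qed.

Lemma etaV x g : eta D x g -> eta D x g^-1%g.
Proof.
move=> xg; have /group_closedV/(_ g) := eta_group D x.
by rewrite !inE; apply.
Qed.

Lemma etaM x g h : eta D x g -> eta D x h -> eta D x (g * h)%g.
Proof.
move=> xg xh; have /group_closedM/(_ g h) := eta_group D x.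
by rewrite !inE; apply.
Qed.

Lemma actK g : cancel (act D g) (act D g^-1%g).
Proof. by move=> x; rewrite -actM mulVg act1. Qed.

Lemma actVK g : cancel (act D g^-1%g) (act D g).
Proof. by move=> x; rewrite -actM mulgV act1. Qed.

Lemma act_fix x g : eta D x g -> act D g x = x.
Proof.
have le y h : eta D y h -> (act D h y <= y)%O.
  by move=> yh; apply: (eta_down Dstd yh); exists y => /=.
move=> xg; apply: le_anti; rewrite le//=.
by rewrite -{1}(actVK g x) act_le le//; exact: etaV.
Qed.

Lemma act_join g x y : act D g (x `|` y)%O = (act D g x `|` act D g y)%O.
Proof.
apply: le_anti; apply/andP; split; last by rewrite leUx !act_le leUl leUr.
rewrite -(act_le D g^-1%g) actK leUx; apply/andP; split.
  by rewrite -{1}(actK g x) act_le leUl.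
by rewrite -{1}(actK g y) act_le leUr.
Qed.

Lemma eta_by g x h : eta D (act D g x) (conjg_by g h) <-> eta D x h.
Proof.
rewrite eta_act; split=> [[h' xh' /(can_inj (conjg_byK g))<-]//|xh].
by exists h.
Qed.

Lemma orbit_refl x : orbit D x x.
Proof. by exists 1%g => //; rewrite act1. Qed.

Lemma orbits_act l g x : orbits D l -> l x -> l (act D g x).
Proof. by move=> [a _ <-] [b _ <-]; exists (g * b)%g; rewrite ?actM. Qed.

Lemma orbits_eq l x : orbits D l -> l x -> l = orbit D x.
Proof.
move=> [a _ <-] [b _ <-]; apply/seteqP; split => _ [g _ <-].
  by exists (g * b^-1)%g; rewrite // actM actK.
by exists (g * b)%g; rewrite // actM.
Qed.

Lemma orbit_reprP l : orbits D l -> l (orbit_repr l).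
Proof. by move=> [a _ <-]; apply: xgetPex; exists a; exact: orbit_refl. Qed.

Lemma conj_class_in c x h h' : conj_classes c ->
    c h -> eta D x h -> c h' -> eta D x h' ->
  exists2 g, eta D x g & conjg_by g h = h'.
Proof.
move=> hc ch xh ch' xh'.
have [cx|[a xa cx]] := conj_class_local Dstd x hc.
  by have : (c `&` eta D x) h by []; rewrite cx.
have : (c `&` eta D x) h by []; rewrite cx => -[b xb <-].
have : (c `&` eta D x) h' by []; rewrite cx => -[b' xb' <-].
by exists (b' * b^-1)%g; [exact/etaM/etaV|rewrite conjg_byM conjg_byK].
Qed.

Lemma xi_fin l' x h :
  finite_set [set x' | [/\ l' x', (x' <= x)%O & eta D x' h]].
Proof. by apply: sub_finite_set (down_finite Dadm x) => y []. Qed.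

Lemma xi_at_act l' x h g : orbits D l' ->
  xi_at D l' (act D g x) (conjg_by g h) = xi_at D l' x h.
Proof.
move=> hl'; rewrite /xi_at; set A := fset_set (mkset _).
set B := fset_set (mkset _).
have -> : A = (act D g @` B)%fset; last first.
  by apply: card_imfset => /=; exact: can_inj (actK g).
apply/fsetP => y; rewrite in_fset_set; last exact: xi_fin.
apply/idP/imfsetP => [|[z]] /=.
  rewrite inE => -[l'y yx yh]; exists (act D g^-1%g y); rewrite ?actVK//.
  rewrite in_fset_set; last exact: xi_fin.
  rewrite inE; split; first exact: orbits_act.
    by rewrite -(act_le D g) actVK.
  by apply/(eta_by g); rewrite actVK.
rewrite in_fset_set; last exact: xi_fin.
rewrite !inE => -[l'z zx zh] ->; split; first exact: orbits_act.
  by rewrite act_le.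
exact/eta_by.
Qed.

(* xi (l',c;l) does not depend on the choice of x in l and h in c(l). *)
Lemma xiE l l' c x h : orbits D l -> orbits D l' -> conj_classes c ->
  l x -> c h -> eta D x h -> xi D l' c l = xi_at D l' x h.
Proof.
move=> hl hl' hc lx ch xh; rewrite /xi.
have lr := orbit_reprP hl.
have : orbit D (orbit_repr l) x by rewrite -(orbits_eq hl lr).
move=> [g _ gx].
have cne : class_in D l c (conjg_by g^-1%g h).
  split; first exact: conj_classes_by.
  by apply/(eta_by g); rewrite gx conjg_byVK.
rewrite ifF; last by apply/negP => /eqP c0; rewrite c0 in cne.
have [cr rr] := xgetI 1%g cne; set r := xget _ _ in cr rr *.
have [b xb <-] : exists2 b, eta D x b & conjg_by b (conjg_by g r) = h.
  apply: (conj_class_in hc) => //; first exact: conj_classes_by.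
  by rewrite -gx; apply/eta_by.
by rewrite -{1}(act_fix xb) !xi_at_act// -gx xi_at_act.
Qed.

Lemma xi_eq0 l l' c : c `&` eta D (orbit_repr l) = set0 -> xi D l' c l = 0%N.
Proof. by move=> c0; rewrite /xi /class_in c0 eqxx. Qed.

Lemma pe_actK g : cancel (pe_act D g) (pe_act D g^-1%g).
Proof. by move=> [x h]; rewrite /pe_act /= actK conjg_byK. Qed.

Lemma pe_actVK g : cancel (pe_act D g^-1%g) (pe_act D g).
Proof. by move=> [x h]; rewrite /pe_act /= actVK conjg_byVK. Qed.

Lemma pe_act_mul g p q :
  pe_act D g (pe_mul p q) = pe_mul (pe_act D g p) (pe_act D g q).
Proof. by rewrite /pe_act /pe_mul /= act_join conjg_byMr. Qed.

Lemma pe_class_act l c g p : orbits D l -> conj_classes c ->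
  pe_class D l c p -> pe_class D l c (pe_act D g p).
Proof.
move=> hl hc [lp [cp ep]]; split; first exact: orbits_act.
by split; [exact: conj_classes_by|apply/eta_by].
Qed.

Lemma pe_class_img l c g : orbits D l -> conj_classes c ->
  pe_act D g @` pe_class D l c = pe_class D l c.
Proof.
move=> hl hc; apply/seteqP; split=> [_ [p lcp <-]|p lcp].
  exact: pe_class_act.
by exists (pe_act D g^-1%g p); [exact: pe_class_act|rewrite pe_actVK].
Qed.

(* (l,c) is a single orbit of partial elements. *)
Lemma pe_class_trans l c p q : orbits D l -> conj_classes c ->
  pe_class D l c p -> pe_class D l c q -> exists g, pe_act D g p = q.
Proof.
move=> hl hc [lp [cp ep]] [lq [cq eq]].
move: lq; rewrite {1}(orbits_eq hl lp) => -[g _ gpq].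
have [b qb bE] : exists2 b, eta D q.1 b & conjg_by b (conjg_by g p.2) = q.2.
  apply: (conj_class_in hc) => //; first exact: conj_classes_by.
  by rewrite -gpq; apply/eta_by.
exists (b * g)%g; rewrite /pe_act actM gpq act_fix// conjg_byM bE.
by case: (q).
Qed.

Lemma pe_classes_disj (X Y : set (Lam * G)) u :
  pe_classes D X -> pe_classes D Y -> X u -> Y u -> X = Y.
Proof.
move=> [[l hl [c hc <-]] _] [[m hm [b hb <-]] _] [lu [cu _]] [mu [bu _]].
by rewrite (orbits_eq hl lu) (orbits_eq hm mu) (conj_classes_eq hc cu)
  (conj_classes_eq hb bu).
Qed.

Lemma pe_class_of t : partial_elt D t ->
  pe_classes D (pe_class D (orbit D t.1) (conj_class t.2)) /\
  pe_class D (orbit D t.1) (conj_class t.2) t.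
Proof.
move=> et; have tX : pe_class D (orbit D t.1) (conj_class t.2) t.
  by do !split => //; [exact: orbit_refl|exact: conj_class_refl].
split=> //; split; last by apply/eqP/set0P; exists t.
by exists (orbit D t.1); [exists t.1|exists (conj_class t.2) => //; exists t.2].
Qed.

Lemma pe_algebraP (f : Lam * G -> k^o) : pe_algebra D f <->
  [/\ forall t, f t != 0 -> partial_elt D t,
      forall g t, partial_elt D t -> f (pe_act D g t) = f t &
      finite_set [set orbit D t.1 | t in [set t | f t != 0]]].
Proof.
split=> [[a fa]|[fpe fG ffin]].
  have fE X t : pe_classes D X -> X t -> a X = f t.
    by apply: coords_of_val fa; exact: pe_classes_disj.
  have fX t : f t != 0 -> exists X, [/\ pe_classes D X, X t & a X != 0].
    have [afin aB ->] := fa; rewrite fct_sumE => ft.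
    have /existsNP[X /not_implyP[Xs /eqP]] : ~ forall X,
        X \in finite_support 0 (pe_classes D) (fun X => a X *: set_sum k X) ->
        (a X *: set_sum k X) t = 0.
      by move=> F0; move/eqP: ft; apply; rewrite big_seq big1.
    rewrite scale_set_sumE mulf_eq0 negb_or => /andP[aX Xt].
    exists X; split=> //; last first.
      by apply/set_mem; move: Xt; case: (_ \in _); rewrite ?eqxx.
    by apply: contrapT => /aB aX0; rewrite aX0 eqxx in aX.
  split.
  - by move=> t /fX[_ [[[l _ [c _ <-]] _] [_ [_ ?]] _]].
  - move=> g t /pe_class_of[BX Xt]; rewrite -(fE _ _ BX Xt); apply/esym.
    apply: fE => //; apply: pe_class_act Xt; [by exists t.1|by exists t.2].
  - have [afin aB _] := fa.
    apply: (@sub_finite_set _ _ ((fun X => orbit D (xget (\bot%O, 1%g) X).1) @`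
      [set X | a X != 0])); last exact: finite_image.
    move=> _ [t /fX[X [BX Xt aX]] <-]; exists X => //.
    have := xgetI (\bot%O, 1%g) Xt; case: BX Xt => -[l hl [c hc <-]] _ [lt _] [lr _].
    by rewrite -(orbits_eq hl lr) (orbits_eq hl lt).
apply: coords_of_ex.
- exact: pe_classes_disj.
- move=> X t u [[l hl [c hc <-]] _] Xt Xu.
  have [g <-] := pe_class_trans hl hc Xt Xu; rewrite fG//.
  by case: Xt => _ [].
- by move=> t /fpe/pe_class_of[BX Xt]; exists (pe_class D (orbit D t.1) (conj_class t.2)).
- apply: (@sub_finite_set _ _
    (\bigcup_(l in [set orbit D t.1 | t in [set t | f t != 0]])
    [set pe_class D l (conj_class h) | h in eta D (orbit_repr l)])).
    move=> X [[[l hl [c hc <-]] _] [t [lt [ct et]] ft]].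
    exists l; first by exists t; rewrite // (orbits_eq hl lt).
    have : orbit D t.1 (orbit_repr l).
      by rewrite -(orbits_eq hl lt); exact: orbit_reprP.
    move=> [g _ gt]; exists (conjg_by g t.2); first by rewrite -gt; apply/eta_by.
    by rewrite -(conj_classes_eq hc)//; exact: conj_classes_by.
  apply: bigcup_finite => // l _.
  by apply: finite_image; exact: (eta_finite Dadm).
Qed.

(* A is closed under multiplication. *)
Lemma pe_algebra_mul (f f' : Lam * G -> k^o) : pe_algebra D f ->
  pe_algebra D f' -> pe_algebra D (formal_mul (@pe_mul d Lam G) f f').
Proof.
move=> /pe_algebraP[fpe fG ffin] /pe_algebraP[f'pe f'G f'fin].
have peE g p : partial_elt D (pe_act D g p) <-> partial_elt D p.
  exact: eta_by.
have GE (h : Lam * G -> k^o) : (forall t, h t != 0 -> partial_elt D t) ->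
    (forall g t, partial_elt D t -> h (pe_act D g t) = h t) ->
    forall g t, h (pe_act D g t) = h t.
  move=> hpe hG g t; have [/(hG g)//|Nt] := pselect (partial_elt D t).
  have -> : h t = 0 by apply/eqP; apply: contra_notT Nt; exact: hpe.
  by apply/eqP; apply: contra_notT Nt => /hpe/peE.
apply/pe_algebraP; split.
- move=> t /formal_mul_neq0[p [<- /fpe p1 /f'pe p2]]; apply: etaM.
    by apply: eta_mono p1; exact: leUl.
  by apply: eta_mono p2; exact: leUr.
- move=> g t _; rewrite /formal_mul (reindex_fsbig
    (fun p : (Lam * G) * (Lam * G) => (pe_act D g p.1, pe_act D g p.2))
    [set p | pe_mul p.1 p.2 = t]); last first.
    split => /=.
    + by move=> p /= pt; rewrite -pe_act_mul pt.
    + by move=> [[x u] [y v]] [[x' u'] [y' v']] _ _ /=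
        [/(can_inj (actK g))-> /(can_inj (conjg_byK g))->
         /(can_inj (actK g))-> /(can_inj (conjg_byK g))->].
    + move=> [a b] /= ab; exists (pe_act D g^-1%g a, pe_act D g^-1%g b).
        by rewrite /= -pe_act_mul ab pe_actK.
      by rewrite /= !pe_actVK.
  by apply: eq_fsbigr => p _ /=; rewrite !GE.
- apply: (@sub_finite_set _ _ (\bigcup_(i in
      [set orbit D t.1 | t in [set t | f t != 0]] `*`
      [set orbit D t.1 | t in [set t | f' t != 0]]) orbit_join D i.1 i.2)).
    move=> _ [t /formal_mul_neq0[p [<- p1 p2]] <-].
    exists (orbit D p.1.1, orbit D p.2.1).
      by split; [exists p.1|exists p.2].
    by exists p.1.1; [exact: orbit_refl|exists p.2.1 => //; exact: orbit_refl].
  apply: bigcup_finite; first exact: finite_setX.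
  move=> [m m'] [/= [t _ <-] [t' _ <-]].
  by apply: (orbit_join_finite Dadm); [exists t.1|exists t'.1].
Qed.

(* The sum defining the product of two class sums is finitely supported. *)
Lemma pe_prod_finite l' c' l'' c'' t :
  finite_set ([set p : (Lam * G) * (Lam * G) | pe_mul p.1 p.2 = t] `&`
    (fun p => set_sum k (pe_class D l' c') p.1 *
              set_sum k (pe_class D l'' c'') p.2) @^-1` [set~ 0]).
Proof.
have fin : finite_set ([set y | (y <= t.1)%O] `*` eta D t.1).
  by apply: finite_setX; [exact: (down_finite Dadm)|exact: (eta_finite Dadm)].
apply: sub_finite_set (finite_setX fin fin) => -[p q] [/= <- /eqP].
rewrite mulf_eq0 negb_or => /andP[/set_sum_neq0[_ [_ ep]] /set_sum_neq0[_ [_ eq]]].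
by split; split=> /=; rewrite ?leUl ?leUr//; [apply: eta_mono ep|
  apply: eta_mono eq]; rewrite ?leUl ?leUr.
Qed.

Section Product.
Variables (l' l'' : set Lam) (c' c'' : set G).
Hypotheses (hl' : orbits D l') (hl'' : orbits D l'').
Hypotheses (hc' : conj_classes c') (hc'' : conj_classes c'').

Let prod := formal_mul (@pe_mul d Lam G)
  (set_sum k (pe_class D l' c')) (set_sum k (pe_class D l'' c'')).

Lemma pe_prod_const l c p q : orbits D l -> conj_classes c ->
  pe_class D l c p -> pe_class D l c q -> prod p = prod q.
Proof.
move=> hl hc lp lq; have [g <-] := pe_class_trans hl hc lp lq.
rewrite /prod -{2}(pe_class_img g hl' hc') -{2}(pe_class_img g hl'' hc'').
rewrite (formal_mul_equiv _ _ _ _ (pe_actK g) (pe_actVK g))//.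
exact: pe_act_mul.
Qed.

Lemma pe_prod_neq0 t : prod t != 0 ->
  orbit_join D l' l'' (orbit D t.1) /\ eta D t.1 t.2.
Proof.
move=> /formal_mul_neq0[[p q] /= [<- /set_sum_neq0[lp [_ ep]]]].
move=> /set_sum_neq0[lq [_ eq]]; split; first by exists p.1 => //; exists q.1.
apply: etaM; first by apply: eta_mono ep; exact: leUl.
by apply: eta_mono eq; exact: leUr.
Qed.

(* The product of two basis elements of A lies in A. *)
Lemma pe_prod_coords : coords_of (pe_classes D) prod (coords (pe_classes D) prod).
Proof.
apply/coordsP/coords_of_ex.
- exact: pe_classes_disj.
- by move=> X t u [[l hl [c hc <-]] _]; exact: pe_prod_const.
- move=> t /pe_prod_neq0[_ et]; exists (pe_class D (orbit D t.1) (conj_class t.2)).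
    split; first by exists (orbit D t.1); [exists t.1|exists (conj_class t.2) => //; exists t.2].
    by apply/eqP/set0P; exists t; do !split => //;
      [exact: orbit_refl|exact: conj_class_refl].
  by do !split => //; [exact: orbit_refl|exact: conj_class_refl].
- apply: (@sub_finite_set _ _ (\bigcup_(l in orbit_join D l' l'')
    [set pe_class D l (conj_class h) | h in eta D (orbit_repr l)])).
    move=> X [[[l hl [c hc <-]] _] [t [lt [ct et]] /pe_prod_neq0[jt _]]].
    exists l; first by rewrite (orbits_eq hl lt).
    have : orbit D t.1 (orbit_repr l).
      by rewrite -(orbits_eq hl lt); exact: orbit_reprP.
    move=> [g _ gt]; exists (conjg_by g t.2); first by rewrite -gt; apply/eta_by.
    by rewrite -(conj_classes_eq hc)//; exact: conj_classes_by.
  apply: bigcup_finite; first exact: (orbit_join_finite Dadm).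
  by move=> l _; apply: finite_image; exact: (eta_finite Dadm).
Qed.

(* P is the coefficient of any element of (l,c) in the product. *)
Lemma pe_coefE l c t : orbits D l -> conj_classes c -> pe_class D l c t ->
  pe_coef k D (pe_class D l' c') (pe_class D l'' c'') (pe_class D l c) = prod t.
Proof.
move=> hl hc lct.
have lc0 : pe_class D l c != set0 by apply/set0P; exists t.
rewrite /pe_coef (negPf lc0) orbF; case: ifPn => [w0|_].
  apply/esym/eqP; apply: contraTT w0 => /formal_mul_neq0[p [_ +]].
  by move=> /set_sum_neq0 p1 /set_sum_neq0 p2; rewrite negb_or;
    apply/andP; split; apply/set0P; [exists p.1|exists p.2].
apply: coords_of_val pe_prod_coords _ lct; first exact: pe_classes_disj.
by split; [exists l => //; exists c|apply/eqP].
Qed.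

Lemma pe_coef_empty l c : pe_class D l c = set0 ->
  pe_coef k D (pe_class D l' c') (pe_class D l'' c'') (pe_class D l c) = 0.
Proof. by move=> lc0; rewrite /pe_coef lc0 eqxx !orbT. Qed.

(* For fixed c, only finitely many P_{(l',c'),(l'',c'')}^{(l,c)} are nonzero. *)
Lemma pe_coef_finite c : conj_classes c ->
  finite_set [set l | orbits D l /\ pe_coef k D (pe_class D l' c')
    (pe_class D l'' c'') (pe_class D l c) != 0].
Proof.
move=> hc; apply: sub_finite_set (orbit_join_finite Dadm hl' hl'') => l [hl].
have [->|/set0P[t lct]] := eqVneq (pe_class D l c) set0.
  by rewrite /pe_coef eqxx !orbT eqxx.
rewrite (pe_coefE hl hc lct) => /pe_prod_neq0[jt _].
by case: lct => lt _; rewrite (orbits_eq hl lt).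
Qed.

End Product.

Section Center.
Variable x : Lam.

Lemma group_classes_disj (X Y : set G) u :
  group_classes D x X -> group_classes D x Y -> X u -> Y u -> X = Y.
Proof.
move=> [[c hc <-] _] [[b hb <-] _] [cu _] [bu _].
by rewrite (conj_classes_eq hc cu) (conj_classes_eq hb bu).
Qed.

Lemma group_span (f : G -> k^o) : group_algebra (eta D x) f ->
    (forall g h, eta D x g -> eta D x h -> f (conjg_by g h) = f h) ->
  exists a, coords_of (group_classes D x) f a.
Proof.
move=> fx fJ; apply: coords_of_ex.
- exact: group_classes_disj.
- move=> X t u [[c hc <-] _] [ct et] [cu eu].
  by have [g xg <-] := conj_class_in hc ct et cu eu; rewrite fJ.
- move=> t ft; have et : eta D x t by apply: contrapT => /fx ft0; rewrite ft0 eqxx in ft.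
  exists (conj_class t `&` eta D x); last by split => //; exact: conj_class_refl.
  split; first by exists (conj_class t) => //; exists t.
  by apply/eqP/set0P; exists t; split => //; exact: conj_class_refl.
- apply: (@sub_finite_set _ _ [set conj_class h `&` eta D x | h in eta D x]).
    move=> X [[[c hc <-] _] [t [ct et] _]]; exists t => //.
    by rewrite -(conj_classes_eq hc ct).
  by apply: finite_image; exact: (eta_finite Dadm).
Qed.

(* The sum defining a product in k[G_x] is finitely supported. *)
Lemma group_prod_finite (f f' : G -> k^o) t :
    group_algebra (eta D x) f -> group_algebra (eta D x) f' ->
  finite_set ([set p : G * G | (p.1 * p.2)%g = t] `&`
    (fun p => f p.1 * f' p.2) @^-1` [set~ 0]).
Proof.
move=> fx f'x; have fin := eta_finite Dadm x.
apply: sub_finite_set (finite_setX fin fin) => -[g h] [_ /= /eqP].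
rewrite mulf_eq0 negb_or => /andP[fg f'h]; split => /=; apply: contrapT.
  by move=> /fx fg0; rewrite fg0 eqxx in fg.
by move=> /f'x fh0; rewrite fh0 eqxx in f'h.
Qed.

Lemma formal_mul_deltar (f : G -> k^o) g t :
  formal_mul *%g f (set_sum k [set g]) t = f (t * g^-1)%g.
Proof.
rewrite /formal_mul -(@fsbig_widen _ _ _ _ [set ((t * g^-1)%g, g)]).
- by rewrite fsbig_set1 /= set_sum_in// mulr1.
- by move=> _ -> /=; rewrite mulgVK.
- move=> [a b] /= [<- ab]; rewrite set_sum_out ?mulr0// => /= bg.
  by apply: ab; rewrite bg mulgK.
Qed.

Lemma formal_mul_deltal (f : G -> k^o) g t :
  formal_mul *%g (set_sum k [set g]) f t = f (g^-1 * t)%g.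
Proof.
rewrite /formal_mul -(@fsbig_widen _ _ _ _ [set (g, (g^-1 * t)%g)]).
- by rewrite fsbig_set1 /= set_sum_in// mul1r.
- by move=> _ -> /=; rewrite mulVKg.
- move=> [a b] /= [<- ab]; rewrite set_sum_out ?mul0r// => /= bg.
  by apply: ab; rewrite bg mulKg.
Qed.

(* The sums of the nonempty c(x) form a basis of the center of k[G_x]. *)
Lemma group_centerE : group_center (eta D x) =
  [set f : G -> k^o | exists a, coords_of (group_classes D x) f a].
Proof.
apply/seteqP; split => f.
  move=> [fx fC]; apply: group_span => // g h xg xh.
  have : group_algebra (eta D x) (set_sum k [set g]).
    by move=> u xu; apply: set_sum_out => ug; apply: xu; rewrite ug.
  move=> /fC /(congr1 (fun F => F (g * h)%g)).
  by rewrite formal_mul_deltar formal_mul_deltal mulKg.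
move=> [a fa]; have fE c h : conj_classes c -> c h -> eta D x h ->
    f h = a (c `&` eta D x).
  move=> hc ch xh; apply/esym; apply: coords_of_val fa _ _ => //.
  - exact: group_classes_disj.
  - by split; [exists c|apply/eqP/set0P; exists h].
have fx : group_algebra (eta D x) f.
  move=> h xh; have [afin aB ->] := fa; rewrite fct_sumE big_seq big1// => X.
  rewrite in_finite_support; last first.
    apply: sub_finite_set afin => Y [_] /=.
    by apply: contra_not_neq => ->; rewrite scale0r.
  by rewrite inE => -[[[c _ <-] _] _]; rewrite scale_set_sumE memNset ?mulr0// => -[].
split => // f' f'x; apply/funext => t; rewrite /formal_mul.
rewrite [RHS](reindex_fsbig (fun p : G * G => (p.2, p.2^-1 * p.1 * p.2)%g)
  [set p : G * G | (p.1 * p.2)%g = t]); last first.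
  split => /=.
  - by move=> [u v] /= <-; rewrite !mulgA mulgV mul1g.
  - by move=> [u v] [u' v'] _ _ /= [-> /mulIg/mulgI->].
  - move=> [u v] /= uv; exists ((u * v * u^-1)%g, u); rewrite /= ?mulgVK//.
    by rewrite !mulgA mulVg mul1g mulgVK.
apply: eq_fsbigr => -[u v] _ /=.
have [xv|/f'x->] := pselect (eta D x v); last by rewrite mulr0 mul0r.
rewrite mulrC; congr (_ * _).
have [xu|xu] := pselect (eta D x u).
  have hu : conj_classes (conj_class u) by exists u.
  rewrite (fE _ _ hu (conj_class_refl u) xu); apply/esym; apply: fE hu _ _.
    by exists v^-1%g => //; rewrite /conjg_by invgK.
  by apply: etaM => //; apply: etaM => //; exact: etaV.
rewrite !fx// => xvu; apply: xu.
have -> : u = (v * (v^-1 * u * v) * v^-1)%g by rewrite !mulgA mulgV mul1g mulgK.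
by apply: etaM; [exact: etaM|exact: etaV].
Qed.

Variables c' c'' : set G.
Hypotheses (hc' : conj_classes c') (hc'' : conj_classes c'').

Let prod := formal_mul *%g (set_sum k (c' `&` eta D x))
                           (set_sum k (c'' `&` eta D x)).

Lemma class_in_img c g : conj_classes c -> 
  conjg_by g @` (c `&` eta D x) = c `&` eta D (act D g x).
Proof.
move=> hc; apply/seteqP; split=> [_ [h [ch xh] <-]|h [ch xh]].
  by split; [exact: conj_classes_by|apply/eta_by].
exists (conjg_by g^-1%g h); last by rewrite conjg_byVK.
split; first exact: conj_classes_by.
by apply/(eta_by g); rewrite conjg_byVK.
Qed.

Lemma group_prod_coords :
  coords_of (group_classes D x) prod (coords (group_classes D x) prod).
Proof.
apply/coordsP/group_span.
  move=> t xt; apply/eqP; apply: contra_notT xt => /formal_mul_neq0[p [<-]].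
  by move=> /set_sum_neq0[_ p1] /set_sum_neq0[_ p2]; exact: etaM.
move=> g h xg xh; rewrite /prod.
rewrite -{1 2}(act_fix xg) -(class_in_img g hc') -(class_in_img g hc'').
rewrite (formal_mul_equiv _ _ _ _ (conjg_byK g) (conjg_byVK g))//.
exact: conjg_byMr.
Qed.

(* S is the coefficient of any element of c(x) in the product. *)
Lemma centerS_atE c h : conj_classes c -> c h -> eta D x h ->
  centerS_at k D x c' c'' c = prod h.
Proof.
move=> hc ch xh; have c0 : c `&` eta D x != set0 by apply/set0P; exists h.
rewrite /centerS_at (negPf c0) orbF; case: ifPn => [w0|_].
  apply/esym/eqP; apply: contraTT w0 => /formal_mul_neq0[p [_ +]].
  by move=> /set_sum_neq0 p1 /set_sum_neq0 p2; rewrite negb_or;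
    apply/andP; split; apply/set0P; [exists p.1|exists p.2].
apply: (coords_of_val (t := h)) group_prod_coords _ _ => //.
  exact: group_classes_disj.
by split; [exists c|apply/eqP].
Qed.

End Center.

(* S does not depend on the choice of x in l. *)
Lemma centerSE l c c' c'' x : orbits D l -> conj_classes c ->
    conj_classes c' -> conj_classes c'' -> l x ->
  centerS k D l c' c'' c = centerS_at k D x c' c'' c.
Proof.
move=> hl hc hc' hc'' lx; rewrite /centerS; set r := orbit_repr l.
have : orbit D r x by rewrite -(orbits_eq hl (orbit_reprP hl)).
move=> [g _ <-].
have [c0|/set0P[h [ch rh]]] := eqVneq (c `&` eta D r) set0.
  by rewrite /centerS_at -!(class_in_img r g)// c0 image_set0 eqxx !orbT.
rewrite (centerS_atE hc' hc'' hc ch rh).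
rewrite (@centerS_atE (act D g r) _ _ hc' hc'' c (conjg_by g h))//.
- rewrite -!class_in_img//.
  rewrite (formal_mul_equiv _ _ _ _ (conjg_byK g) (conjg_byVK g))//.
  exact: conjg_byMr.
- exact: conj_classes_by.
- exact/eta_by.
Qed.

End Theory.

(* Main.v *)
(** Fix [x] in [l] and [h] in [c(x)].  Both sides count, in [k], the pairs of
    partial elements [(y, u)] in [(l',c')] and [(z, v)] in [(l'',c'')] with
    [y, z <= x] and [u * v = h].  Grouping the pairs by [(u, v)] gives the left
    side, since the number of admissible [y] is [xi (l',c';l)] for every [u] in
    [c'(x)]; grouping them by [y `|` z] gives the right side. *)
Require Import Defs.
From mathcomp Require Import all_boot all_order all_algebra finmap.
From mathcomp Require Import boolp classical_sets functions cardinality fsbigop.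

Import Order.TTheory GRing.Theory.

Local Open Scope classical_set_scope.
Local Open Scope ring_scope.

(** Serves to pass from the grouping by [(u, v)] to sums over pairs of partial elements [p = (y, u)]
    and [q = (z, v)]. *)
Lemma fsum_setX4 (V : nmodType) (S T : choiceType) (X : set S) (E : set T)
    (F : T -> T -> S -> S -> V) : finite_set X -> finite_set E ->
  \sum_(u \in E) \sum_(v \in E) \sum_(y \in X) \sum_(z \in X) F u v y z =
  \sum_(p \in X `*` E) \sum_(q \in X `*` E) F p.2 q.2 p.1 q.1.
Proof.
move=> Xfin Efin; have XEfin : finite_set (X `*` E) by exact: finite_setX.
rewrite -(@pair_fsbig _ _ _ _ _ X E
  (fun y u => \sum_(q \in X `*` E) F u q.2 y q.1))//.
rewrite [RHS]exchange_fsbig//; apply: eq_fsbigr => u _.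
rewrite [LHS]exchange_fsbig//; apply: eq_fsbigr => y _.
by rewrite exchange_fsbig// (@pair_fsbig _ _ _ _ _ X E (fun z v => F u v y z)).
Qed.

Section FormalMul.
Context (k : fieldType) (T : choiceType).
Set Implicit Arguments.

(** Moving the constraint [mul p q = t] from the index set into a 0/1 factor lets [p] and [q] range
    independently over finite sets, so that the sums can be exchanged. *)
Lemma formal_mul_finite (mul : T -> T -> T) (f g : T -> k^o) t (A B : set T) :
    finite_set A -> finite_set B ->
    (forall p q, mul p q = t -> f p != 0 -> g q != 0 -> A p /\ B q) ->
  formal_mul mul f g t =
  \sum_(p \in A) \sum_(q \in B) f p * g q * (mul p q == t)%:R.
Proof.
move=> Afin Bfin AB; rewrite pair_fsbig//.
rewrite [RHS](@fsbig_widen _ _ _ _ (A `*` B) [set: T * T])//=; last first.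
  move=> [p q] [_ /= npq]; have [pqt|_] := eqVneq (mul p q) t; last first.
    by rewrite mulr0.
  rewrite mulr1; apply/eqP; apply: contra_notT npq.
  by rewrite mulf_eq0 negb_or => /andP[fp gq]; exact: AB.
rewrite /formal_mul fsbig_mkcond; apply: eq_fsbigr => -[p q] _.
rewrite /patch; have [pqt|pqt] /= := eqVneq (mul p q) t.
  by rewrite mem_set// mulr1.
by rewrite memNset ?mulr0// => /eqP; rewrite (negPf pqt).
Qed.

End FormalMul.

Section Counting.
Context (d : Order.disp_t) (Lam : bJoinSemilatticeType d) (G : groupType).
Context (k : fieldType) (D : data Lam G).
Hypotheses (Dadm : admissible D) (Dstd : standing D).
Set Implicit Arguments.
Local Notation down x := [set y : Lam | (y <= x)%O].

(** The index set [down x] depends on neither [l] nor [h], so this form can be exchanged with sums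
    over orbits. *)
Lemma xi_at_sum l x h : (xi_at D l x h)%:R =
  \sum_(y \in down x) ((y \in [set y | l y /\ eta D y h])%:R : k).
Proof.
rewrite /xi_at.
under [RHS]eq_fsbigr do rewrite mulrb.
rewrite -fsbig_mkcondr fsbig_finite; last first.
  by apply: finite_setIl; exact: (down_finite Dadm).
rewrite big_const_seq count_predT iter_addr_0.
congr (_%:R); congr (#|` fset_set _|).
by apply/seteqP; split=> y /= => [[? ? ?]|[? [? ?]]].
Qed.

(** For [u] in [c'] the sum counts the [y <= x] in [l'] with [u] in [eta D y], a number that [xiE]
    shows to be the same for all such [u]; for other [u] every term vanishes. *)
Lemma pe_class_fiber_sum {l l' : set Lam} {c' : set G} {x u} :
    orbits D l -> orbits D l' -> conj_classes c' -> l x -> eta D x u ->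
  \sum_(y \in down x) set_sum k (pe_class D l' c') (y, u) =
  (xi D l' c' l)%:R * set_sum k (c' `&` eta D x) u.
Proof.
move=> hl hl' hc' lx xu; have [cu|ncu] := pselect (c' u); last first.
  rewrite set_sum_out ?mulr0; last by case.
  by apply: fsbig1 => y _; rewrite set_sum_out// => -[_ []].
rewrite set_sum_in// mulr1 (xiE Dadm Dstd hl hl' hc' lx cu xu) xi_at_sum.
apply: eq_fsbigr => y _; rewrite /set_sum; congr (_%:R); congr nat_of_bool.
by apply/idP/idP; rewrite !inE => -[? yu]; do !split => //; case: yu.
Qed.

Context {l l' l'' : set Lam} {c c' c'' : set G}.
Context (hl : orbits D l) (hl' : orbits D l') (hl'' : orbits D l'').
Context (hc : conj_classes c) (hc' : conj_classes c') (hc'' : conj_classes c'').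
Context {x : Lam} {h : G} (lx : l x) (ch : c h) (xh : eta D x h).

Let f' := set_sum k (pe_class D l' c').
Let f'' := set_sum k (pe_class D l'' c'').
Let X := down x.
Let E := eta D x.
Let Xfin : finite_set X := down_finite Dadm x.
Let Efin : finite_set E := eta_finite Dadm x.

Lemma xi_centerS_sum :
  (xi D l' c' l)%:R * (xi D l'' c'' l)%:R * centerS k D l c' c'' c =
  \sum_(u \in E) \sum_(v \in E) \sum_(y \in X) \sum_(z \in X)
     f' (y, u) * f'' (z, v) * ((u * v)%g == h)%:R.
Proof.
rewrite (centerSE k Dadm Dstd hl hc hc' hc'' lx).
rewrite (centerS_atE k Dadm Dstd hc' hc'' hc ch xh).
rewrite (@formal_mul_finite _ _ _ _ _ h E E)//; last first.
  by move=> u v _ /set_sum_neq0[_ Eu] /set_sum_neq0[_ Ev].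
rewrite mulr_fsumr; apply: eq_fsbigr => u; rewrite inE => Eu.
rewrite mulr_fsumr; apply: eq_fsbigr => v; rewrite inE => Ev.
(* For fixed [u] and [v] the sum over [y] and [z] splits into a product of two fibre sums. *)
rewrite !mulrA; under eq_fsbigr do rewrite -mulr_fsuml -mulr_fsumr.
rewrite -mulr_fsuml -mulr_fsuml.
rewrite (pe_class_fiber_sum hl hl' hc' lx Eu).
rewrite (pe_class_fiber_sum hl hl'' hc'' lx Ev).
by congr (_ * _); rewrite -!mulrA; congr (_ * _); rewrite mulrCA.
Qed.

(** If the join of [a] and [b] is [y <= x], then [a, b <= x], and [eta_mono] puts their group
    components in [E]. *)
Lemma pe_prod_sum y : (y <= x)%O ->
  formal_mul (@pe_mul d Lam G) f' f'' (y, h) =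
  \sum_(p \in X `*` E) \sum_(q \in X `*` E)
     f' p * f'' q * (pe_mul p q == (y, h))%:R.
Proof.
move=> yx; apply: formal_mul_finite; try exact: finite_setX.
move=> [a u] [b v] [aby _] /set_sum_neq0[_ [_ /= au]] /set_sum_neq0[_ [_ /= bv]].
have /andP[ax bx] : (a <= x)%O && (b <= x)%O by rewrite -leUx aby.
by split; split=> //=; [exact: eta_mono au|exact: eta_mono bv].
Qed.

(** Each [y <= x] lies in exactly one orbit, so expanding [xi] as a count of such [y] turns the sum
    over orbits into a sum over [y]. *)
Lemma xi_pe_coef_sum :
  \sum_(lt \in orbits D)
     ((xi D lt c l)%:R *
      pe_coef k D (pe_class D l' c') (pe_class D l'' c'') (pe_class D lt c)) =
  \sum_(y \in X) formal_mul (@pe_mul d Lam G) f' f'' (y, h).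
Proof.
have xiP lt : orbits D lt -> (xi D lt c l)%:R =
    \sum_(y \in X) ((y \in [set y | lt y /\ eta D y h])%:R : k).
  by move=> hlt; rewrite (xiE Dadm Dstd hl hlt hc lx ch xh) xi_at_sum.
have OX : finite_set (Defs.orbit D @` X) by exact: finite_image.
(* Orbits that miss [X] have [xi] equal to 0; finitely many remain, as the exchange of sums
   requires. *)
rewrite -(@fsbig_widen _ _ _ _ (Defs.orbit D @` X)); first last.
- move=> lt [hlt /= nlt]; rewrite xiP// fsbig1 ?mul0r// => y yx.
  rewrite memNset// => -[lty _]; apply: nlt.
  by exists y => //; rewrite (orbits_eq hlt lty).
- by move=> _ [y _ <-]; exists y.
under eq_fsbigr => lt.
  rewrite inE => -[z _ zlt]; have hlt : orbits D lt by exists z.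
  rewrite xiP// mulr_fsuml; over.
rewrite exchange_fsbig//; apply: eq_fsbigr => y; rewrite inE => yx.
rewrite -(@fsbig_widen _ _ _ _ [set Defs.orbit D y]); first last.
- move=> lt [[z _ zlt] /= nlt]; rewrite memNset ?mul0r// => -[lty _].
  have hlt : orbits D lt by exists z.
  by apply: nlt; rewrite (orbits_eq hlt lty).
- by move=> _ ->; exists y.
rewrite fsbig_set1.
have hy : orbits D (Defs.orbit D y) by exists y.
have [yh|nyh] := pselect (eta D y h).
  rewrite mem_set ?mul1r; last by split => //; exact: orbit_refl.
  apply: pe_coefE => //; split => //; exact: orbit_refl.
(* Here [(y, h)] is not a partial element, so the product has coefficient 0 at it. *)
rewrite memNset ?mul0r; last by case.
apply/esym/eqP; apply: contra_notT nyh.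
by move=> /pe_prod_neq0[].
Qed.

(** For a given pair only [y] equal to the join of [a] and [b] contributes, and this join lies in
    [X] because [a, b <= x]. *)
Lemma pe_prod_sum_pairs :
  \sum_(y \in X) formal_mul (@pe_mul d Lam G) f' f'' (y, h) =
  \sum_(p \in X `*` E) \sum_(q \in X `*` E)
     f' p * f'' q * ((p.2 * q.2)%g == h)%:R.
Proof.
have XEfin : finite_set (X `*` E) by exact: finite_setX.
under eq_fsbigr => y do rewrite inE => /pe_prod_sum ->.
rewrite exchange_fsbig//; apply: eq_fsbigr => -[a u].
rewrite inE => -[/= ax _].
rewrite exchange_fsbig//; apply: eq_fsbigr => -[b v].
rewrite inE => -[/= bx _].
rewrite -(@fsbig_widen _ _ _ _ [set (a `|` b)%O]); first last.
- by move=> y [_ /= /eqP aby]; rewrite xpair_eqE eq_sym (negPf aby) mulr0.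
- by move=> _ ->; rewrite /X /= leUx ax bx.
by rewrite fsbig_set1 xpair_eqE eqxx.
Qed.

End Counting.

Theorem lemma5p2 (k : fieldType) (d : Order.disp_t)
    (Lam : bJoinSemilatticeType d) (G : groupType) (D : data Lam G)
    (Dadm : admissible D) (Dstd : standing D)
    (l l' l'' : set Lam) (c c' c'' : set G)
    (hl : orbits D l) (hl' : orbits D l') (hl'' : orbits D l'')
    (hc : conj_classes c) (hc' : conj_classes c')
    (hc'' : conj_classes c'') :
  (xi D l' c' l)%:R * (xi D l'' c'' l)%:R * centerS k D l c' c'' c =
  \sum_(lt \in orbits D)
     ((xi D lt c l)%:R *
      pe_coef k D (pe_class D l' c') (pe_class D l'' c'') (pe_class D lt c)).
Proof.
(* If [c(l)] is empty there is no [h] to fix, but [centerS] and every [xi D lt c l] are 0 by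
   convention. *)
have [c0|/set0P[h [ch xh]]] := eqVneq (c `&` eta D (orbit_repr l)) set0.
  rewrite /centerS /centerS_at c0 eqxx !orbT mulr0.
  by rewrite fsbig1// => lt _; rewrite xi_eq0// mul0r.
have lx := orbit_reprP hl.
rewrite (xi_centerS_sum k Dadm Dstd hl hl' hl'' hc hc' hc'' lx ch xh).
rewrite (xi_pe_coef_sum k Dadm Dstd hl hl' hl'' hc hc' hc'' lx ch xh).
rewrite pe_prod_sum_pairs// fsum_setX4; first last.
- exact: (eta_finite Dadm).
- exact: (down_finite Dadm).
by apply: eq_fsbigr => -[a u] _; apply: eq_fsbigr => -[b v] _.
Qed.
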